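(* Let $\mathcal{D}$ be a dialgebra over a field $K$ of characteristic zero. Then the space $\mathrm{Der}(\mathcal{D})$ of derivations of $\mathcal{D}$ is a Lie subalgebra of $\mathfrak{gl}(\mathcal{D})$.
   Context: A dialgebra over $K$ is a $K$-vector space $\mathcal{D}$ with two bilinear associative products $\vdash,\dashv:\mathcal{D}\times\mathcal{D}\to\mathcal{D}$ satisfying, for all $x,y,z\in\mathcal{D}$: $x\dashv(y\dashv z)=x\dashv(y\vdash z)$, $(x\dashv y)\vdash z=(x\vdash y)\vdash z$, and $x\vdash(y\dashv z)=(x\vdash y)\dashv z$. A derivation of $\mathcal{D}$ is a $K$-linear map $d:\mathcal{D}\to\mathcal{D}$ such that $d(a*b)=d(a)*b+a*d(b)$ for all $a,b\in\mathcal{D}$ and for each of the two products $*\in\{\vdash,\dashv\}$. $\mathrm{Der}(\mathcal{D})$ is the vector space of all derivations of $\mathcal{D}$. $\mathfrak{gl}(\mathcal{D})$ is the Lie algebra of all $K$-linear maps $\mathcal{D}\to\mathcal{D}$ with bracket $[S,T]=ST-TS$. *)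

(* Defs.v *)
From HB Require Import structures.
From mathcomp Require Import all_boot all_order all_algebra sesquilinear.
From mathcomp Require Import boolp functions.

Set Implicit Arguments.
Unset Strict Implicit.
Unset Printing Implicit Defensive.

Import GRing.Theory.
Local Open Scope ring_scope.

HB.mixin Record Lmodule_isDialgebra (K : fieldType) D of GRing.Lmodule K D := {
  lprod : D -> D -> D;
  rprod : D -> D -> D;
  lprod_bilinear : bilinear_for *:%R *:%R lprod;
  rprod_bilinear : bilinear_for *:%R *:%R rprod;
  lprodA : associative lprod;
  rprodA : associative rprod;
  lprod_bar : forall x y z, lprod x (lprod y z) = lprod x (rprod y z);
  rprod_bar : forall x y z, rprod (lprod x y) z = rprod (rprod x y) z;
  rlprodA : forall x y z, rprod x (lprod y z) = lprod (rprod x y) z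
}.

#[short(type="dialgType")]
HB.structure Definition Dialgebra (K : fieldType) :=
  { D of GRing.Lmodule K D & Lmodule_isDialgebra K D }.

Notation "x ⊣ y" := (lprod x y) (at level 40, left associativity) : ring_scope.
Notation "x ⊢ y" := (rprod x y) (at level 40, left associativity) : ring_scope.

HB.mixin Record Lmodule_isLieAlgebra (K : fieldType) L of GRing.Lmodule K L := {
  lie_bracket : L -> L -> L;
  lie_bilinear : bilinear_for *:%R *:%R lie_bracket;
  lie_alternating : forall x, lie_bracket x x = 0;
  lie_jacobi : forall x y z,
    lie_bracket x (lie_bracket y z) + lie_bracket y (lie_bracket z x)
      + lie_bracket z (lie_bracket x y) = 0
}.

#[short(type="lieAlgType")]
HB.structure Definition LieAlgebra (K : fieldType) :=
  { L of GRing.Lmodule K L & Lmodule_isLieAlgebra K L }.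

Definition lie_subalgebra (K : fieldType) (L : lieAlgType K) (S : {pred L}) :=
  GRing.submod_closed S /\ {in S &, forall x y, lie_bracket x y \in S}.
Arguments lie_subalgebra {K} L S.

Definition gl (K : fieldType) (V : lmodType K) : Type := {linear V -> V}.

Section GeneralLinear.
Variables (K : fieldType) (V : lmodType K).
Implicit Types (a b : K) (f g h : gl V).

(* V may be infinite-dimensional: equality of linear maps is not decidable
   constructively, hence the classical eqType and choiceType instances. *)
HB.instance Definition _ := gen_eqMixin (gl V).
HB.instance Definition _ := gen_choiceMixin (gl V).

Definition gl_apply f : V -> V := (f : {linear V -> V}).

Lemma glP f g : gl_apply f =1 gl_apply g -> f = g.
Proof.
rewrite /gl_apply; case: f g => [f [[fA] [fZ]]] [g [[gA] [gZ]]] /= /funext fg.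
subst g; have -> : fA = gA by exact: Prop_irrelevance.
by have -> : fZ = gZ by exact: Prop_irrelevance.
Qed.

Definition gl_zero : gl V := (\0 : {linear V -> V}).
Definition gl_opp f : gl V := (\- (f : {linear V -> V}) : {linear V -> V}).
Definition gl_add f g : gl V :=
  ((f : {linear V -> V}) \+ (g : {linear V -> V}) : {linear V -> V}).
Definition gl_scale a f : gl V :=
  (a \*: (f : {linear V -> V}) : {linear V -> V}).
Definition gl_comp f g : gl V :=
  ((f : {linear V -> V}) \o (g : {linear V -> V}) : {linear V -> V}).

Let addA : associative gl_add.
Proof. by move=> f g h; apply: glP => x; exact: addrA. Qed.
Let addC : commutative gl_add.
Proof. by move=> f g; apply: glP => x; exact: addrC. Qed.
Let add0 : left_id gl_zero gl_add.
Proof. by move=> f; apply: glP => x; exact: add0r. Qed.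
Let addN : left_inverse gl_zero gl_opp gl_add.
Proof. by move=> f; apply: glP => x; exact: addNr. Qed.
HB.instance Definition _ := GRing.isZmodule.Build (gl V) addA addC add0 addN.

Let scaleA a b f : gl_scale a (gl_scale b f) = gl_scale (a * b) f.
Proof. by apply: glP => x; exact: scalerA. Qed.
Let scale1 : left_id 1 gl_scale.
Proof. by move=> f; apply: glP => x; exact: scale1r. Qed.
Let scaleDr : right_distributive gl_scale +%R.
Proof. by move=> a f g; apply: glP => x; exact: scalerDr. Qed.
Let scaleDl f : {morph gl_scale^~ f : a b / a + b}.
Proof. by move=> a b; apply: glP => x; exact: scalerDl. Qed.
HB.instance Definition _ :=
  GRing.Zmodule_isLmodule.Build K (gl V) scaleA scale1 scaleDr scaleDl.

Definition gl_bracket f g : gl V := gl_comp f g - gl_comp g f.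

Let gl_bracketE f g x :
  gl_apply (gl_bracket f g) x
    = gl_apply f (gl_apply g x) - gl_apply g (gl_apply f x).
Proof. by []. Qed.
Let gl_addE f g x : gl_apply (f + g) x = gl_apply f x + gl_apply g x.
Proof. by []. Qed.
Let gl_scaleE a f x : gl_apply (a *: f) x = a *: gl_apply f x.
Proof. by []. Qed.
Let gl_applyD f x y : gl_apply f (x + y) = gl_apply f x + gl_apply f y.
Proof. exact: linearD. Qed.
Let gl_applyN f x : gl_apply f (- x) = - gl_apply f x.
Proof. exact: linearN. Qed.
Let gl_applyZ f a x : gl_apply f (a *: x) = a *: gl_apply f x.
Proof. exact: linearZ_LR. Qed.

Let bracket_bilinear : bilinear_for *:%R *:%R gl_bracket.
Proof.
split=> [g a f1 f2|f a g1 g2]; apply: glP => x;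
  rewrite !(gl_addE, gl_scaleE, gl_bracketE) !gl_applyD !gl_applyZ;
  by rewrite scalerBr opprD addrACA.
Qed.
Let bracket_alternating f : gl_bracket f f = 0.
Proof. exact: subrr. Qed.
Let bracket_jacobi f g h :
  gl_bracket f (gl_bracket g h) + gl_bracket g (gl_bracket h f)
    + gl_bracket h (gl_bracket f g) = 0.
Proof.
apply: glP => x; rewrite !(gl_addE, gl_bracketE) !gl_applyD !gl_applyN.
rewrite !opprB.
rewrite !addrA [LHS](ACl (1*12*2*7*3*10*4*5*6*11*8*9)) /=.
by rewrite !(subrr, addNr, add0r).
Qed.

HB.instance Definition _ := Lmodule_isLieAlgebra.Build K (gl V)
  bracket_bilinear bracket_alternating bracket_jacobi.

End GeneralLinear.

Definition derivation (K : fieldType) (D : dialgType K) (d : {linear D -> D}) :=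
  (forall a b, d (a ⊣ b) = d a ⊣ b + a ⊣ d b) /\
  (forall a b, d (a ⊢ b) = d a ⊢ b + a ⊢ d b).

Definition Der (K : fieldType) (D : dialgType K) : {pred gl D} :=
  [pred d | `[< derivation d >]].
Arguments Der {K} D.

(* Main.v *)
Require Import Defs.
From mathcomp Require Import all_boot all_order all_algebra.
From mathcomp Require Import sesquilinear boolp.

Set Implicit Arguments.
Unset Strict Implicit.
Unset Printing Implicit Defensive.

Import GRing.Theory.
Local Open Scope ring_scope.

(** For one fixed bilinear product on a vector space, the endomorphisms that
    satisfy the Leibniz rule form a subspace, because the rule is linear in the
    endomorphism, and they are closed under the commutator: in
    [d (e (a * b)) - e (d (a * b))] the mixed terms [d a * e b] and [e a * d b]
    occur once with each sign and cancel ([leibniz_bracket]).  A derivation of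
    a dialgebra satisfies the Leibniz rule for both products, so [Der D] is the
    intersection of two such Lie subalgebras.  Only the bilinearity of the
    products matters, not the dialgebra identities. *)

Section Leibniz.
Variables (K : fieldType) (V : lmodType K) (op : V -> V -> V).
Hypothesis op_bilinear : bilinear_for *:%R *:%R op.
Implicit Types (c : K) (d e : gl V).

(** [d] is a derivation for the single product [op]; no associativity of [op]
    is assumed. *)
Definition leibniz d :=
  forall a b, gl_apply d (op a b) = op (gl_apply d a) b + op a (gl_apply d b).

Lemma op_linearl c x y z : op (c *: x + y) z = c *: op x z + op y z.
Proof. exact: op_bilinear.1. Qed.

Lemma op_linearr c x y z : op z (c *: x + y) = c *: op z x + op z y.
Proof. exact: op_bilinear.2. Qed.

Lemma op0l z : op 0 z = 0.
Proof. by have := op_linearl (-1) 0 0 z; rewrite scaler0 addr0 scaleN1r addNr. Qed.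

Lemma op0r z : op z 0 = 0.
Proof. by have := op_linearr (-1) 0 0 z; rewrite scaler0 addr0 scaleN1r addNr. Qed.

Lemma opBl x y z : op (x - y) z = op x z - op y z.
Proof. by rewrite addrC -scaleN1r op_linearl scaleN1r addrC. Qed.

Lemma opBr x y z : op z (x - y) = op z x - op z y.
Proof. by rewrite addrC -scaleN1r op_linearr scaleN1r addrC. Qed.

Lemma leibniz0 : leibniz 0.
Proof.
move=> a b; have E x : gl_apply (0 : gl V) x = 0 by [].
by rewrite !E op0l op0r addr0.
Qed.

Lemma leibniz_linear c d e : leibniz d -> leibniz e -> leibniz (c *: d + e).
Proof.
move=> dL eL a b.
have E x : gl_apply (c *: d + e) x = c *: gl_apply d x + gl_apply e x by [].
by rewrite !E dL eL op_linearl op_linearr scalerDr addrACA.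
Qed.

Lemma leibniz_bracket d e :
  leibniz d -> leibniz e -> leibniz (lie_bracket d e).
Proof.
move=> dL eL a b.
have E x : gl_apply (lie_bracket d e) x =
  gl_apply d (gl_apply e x) - gl_apply e (gl_apply d x) by [].
have applyD f x y : gl_apply f (x + y) = gl_apply f x + gl_apply f y :> V.
  exact: linearD.
rewrite !E dL eL !applyD !dL !eL opBl opBr.
(* Exchange the mixed terms [e a * d b] and [d a * e b] in the first sum, so
   that they face their opposites in the second. *)
rewrite !opprD [X in X + _ = _]addrACA [LHS]addrACA.
by congr (_ + _); rewrite addrACA subrr ?addr0 ?add0r.
Qed.

End Leibniz.

Lemma in_Der (K : fieldType) (D : dialgType K) (d : gl D) :
  d \in Der D <-> leibniz (@lprod K D) d /\ leibniz (@rprod K D) d.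
Proof. by rewrite inE; split=> /asboolP. Qed.

Theorem lemma2p5 (K : fieldType) (charK : [pchar K] =i pred0)
    (D : dialgType K) : lie_subalgebra (gl D) (Der D).
Proof.
have [lB rB] := (@lprod_bilinear K D, @rprod_bilinear K D).
split; first split.
- by apply/in_Der; split; apply: leibniz0.
- move=> c d e /in_Der[dl dr] /in_Der[el er].
  by apply/in_Der; split; apply: leibniz_linear.
- move=> d e /in_Der[dl dr] /in_Der[el er].
  by apply/in_Der; split; apply: leibniz_bracket.
Qed.
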